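(* Every $(d,\Delta)$-degenerate graph $H$ with $n$ vertices and chromatic number $q$ satisfies $$r(H)\leq \left(2^{7d+8}d^{3d+2}\Delta\right)^{\log q} n.$$
   Context: The Ramsey number $r(H)$ is the least positive integer $N$ such that every two-coloring of the edges of $K_N$ contains a monochromatic copy of $H$. A graph $H$ is $(d,\Delta)$-degenerate if there is an ordering $v_1,\ldots,v_n$ of its vertices such that for each $v_i$: (1) at most $d$ vertices $v_j$ with $j<i$ are adjacent to $v_i$, and (2) there are at most $\Delta$ subsets $S\subset\{v_1,\ldots,v_i\}$ such that $S=N(v_j)\cap\{v_1,\ldots,v_i\}$ for some neighbor $v_j$ of $v_i$ with $j>i$, where $N(v)$ is the set of neighbors of $v$. Logarithms are base $2$. *)

(* Defs.v *)
From mathcomp Require Import all_boot all_order all_algebra.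
From mathcomp Require Import reals exp.

Set Implicit Arguments.
Unset Strict Implicit.
Unset Printing Implicit Defensive.

Record sgraph := SGraph {
  vertex :> finType;
  adj : rel vertex;
  adj_sym : symmetric adj;
  adj_irr : irreflexive adj
}.

Section Graph.
Variable H : sgraph.

Definition nbhd (x : H) : {set H} := [set y | adj x y].

Definition colorable (k : nat) : bool :=
  [exists f : {ffun H -> 'I_k}, [forall x, forall y, adj x y ==> (f x != f y)]].

Lemma colorable_card : exists k, colorable k.
Proof.
exists #|H|; apply/existsP; exists [ffun x => enum_rank x].
apply/forallP=> x; apply/forallP=> y; apply/implyP=> xy; rewrite !ffunE.
by apply: contraTneq xy => /enum_rank_inj ->; rewrite adj_irr.
Qed.

Definition chromatic_number : nat := ex_minn colorable_card.

(* A coloring of the edges of K_N is given by a function on all subsets of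
   'I_N; only its values on two-element sets matter, as f is injective and
   adjacent vertices are distinct.  The copy of H need not be induced. *)
Definition ramsey_prop (N : nat) : bool :=
  [forall c : {ffun {set 'I_N} -> bool},
    [exists f : {ffun H -> 'I_N}, [exists b : bool,
      injectiveb f &&
      [forall x, forall y, adj x y ==> (c [set f x; f y] == b)]]]].

End Graph.

Lemma ramsey_sets (a b : nat) :
  exists N, forall (T : finType) (c : {set T} -> bool) (A : {set T}),
    N <= #|A| ->
    exists (col : bool) (B : {set T}), [/\ B \subset A,
      #|B| = (if col then a else b)
      & {in B &, forall x y, x != y -> c [set x; y] = col}].
Proof.
elim: a b => [|a IHa] b.
  exists 0 => T c A _; exists true, set0; split; rewrite ?sub0set ?cards0 //.
  by move=> x y; rewrite inE.
elim: b => [|b [N2 IHb]].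
  exists 0 => T c A _; exists false, set0; split; rewrite ?sub0set ?cards0 //.
  by move=> x y; rewrite inE.
have [N1 IHa1] := IHa b.+1.
exists (N1 + N2).+1 => T c A leA.
have /card_gt0P[x xA] : 0 < #|A| by apply: leq_trans leA.
pose P := [set y | c [set x; y]].
have ext (S B : {set T}) (col : bool) : S \subset A :\ x ->
    {in S, forall y, c [set x; y] = col} -> B \subset S ->
    {in B &, forall y z, y != z -> c [set y; z] = col} ->
  [/\ x |: B \subset A, #|x |: B| = #|B|.+1
    & {in x |: B &, forall y z, y != z -> c [set y; z] = col}].
  move=> SA cS BS cB; have BA := subset_trans BS SA.
  have xB : x \notin B.
    by apply/negP => /(subsetP BA); rewrite !inE eqxx.
  split; first by rewrite subUset sub1set xA (subset_trans BA) ?subsetDl.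
    by rewrite cardsU1 xB.
  move=> y z /setU1P[->|yB] /setU1P[->|zB]; first by rewrite eqxx.
  - by move=> _; apply/cS/(subsetP BS).
  - by move=> _; rewrite setUC; apply/cS/(subsetP BS).
  - exact: cB.
have /orP[leN|leN] : (N1 <= #|(A :\ x) :&: P|) || (N2 <= #|(A :\ x) :\: P|).
  rewrite leqNgt -implybE; apply/implyP => lt1; rewrite leqNgt; apply/negP => lt2.
  move: leA; rewrite (cardsD1 x A) xA -(cardsID P (A :\ x)) add1n ltnS leqNgt.
  by rewrite -addSn leq_add // ltnW.
- have [[] [B [BS cardB cB]]] := IHa1 T c _ leN; last first.
    exists false, B; split=> //.
    by rewrite (subset_trans BS) // (subset_trans (subsetIl _ _)) ?subsetDl.
  have cS : {in (A :\ x) :&: P, forall y, c [set x; y] = true}.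
    by move=> y /setIP[_]; rewrite inE.
  have [sub cardE cE] := ext _ B true (subsetIl _ _) cS BS cB.
  by exists true, (x |: B); split; rewrite ?cardE ?cardB.
- have [[] [B [BS cardB cB]]] := IHb T c _ leN.
    exists true, B; split=> //.
    by rewrite (subset_trans BS) // (subset_trans (subsetDl _ _)) ?subsetDl.
  have cS : {in (A :\ x) :\: P, forall y, c [set x; y] = false}.
    by move=> y /setDP[_]; rewrite inE => /negbTE.
  have [sub cardE cE] := ext _ B false (subsetDl _ _) cS BS cB.
  by exists false, (x |: B); split; rewrite ?cardE ?cardB.
Qed.

Lemma ramsey_exists (H : sgraph) : exists N, (0 < N) && ramsey_prop H N.
Proof.
have [N HN] := ramsey_sets #|H| #|H|; exists N.+1; apply/forallP => c.
have [|col [B [_ cardB cB]]] := HN _ c setT; first by rewrite cardsT card_ord.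
have {}cardB : #|H| = #|B| by rewrite cardB; case: (col).
pose g (x : H) : 'I_N.+1 := enum_val (cast_ord cardB (enum_rank x)).
have g_inj : injective g.
  by move=> x y /enum_val_inj/cast_ord_inj/enum_rank_inj.
apply/existsP; exists [ffun x => g x]; apply/existsP; exists col.
apply/andP; split; first by apply/injectiveP => x y; rewrite !ffunE => /g_inj.
apply/forallP=> x; apply/forallP=> y; apply/implyP=> xy; rewrite !ffunE.
apply/eqP/cB; rewrite ?enum_valP //.
by apply: contraTneq xy => /g_inj ->; rewrite adj_irr.
Qed.

Definition ramsey_number (H : sgraph) : nat := ex_minn (ramsey_exists H).

Definition degenerate (d D : nat) (H : sgraph) : Prop :=
  exists2 v : 'I_#|H| -> H, bijective v &
  forall i : 'I_#|H|,
    #|[set j : 'I_#|H| | (j < i) && adj (v i) (v j)]| <= d /\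
    #|[set nbhd (v j) :&: [set v k | k : 'I_#|H| & k <= i]
         | j : 'I_#|H| & (i < j) && adj (v i) (v j)]| <= D.

Definition log2 (R : realType) (x : R) : R := (ln x / ln 2%:R)%R.

(* Main.v *)
Require Import Defs.
From mathcomp Require Import all_boot all_order all_algebra.
From mathcomp Require Import reals exp zify ring lra.

(** Call the two colours red and blue, let [n = #|H|], let [q] be the chromatic
number, and put [L = 8 d^2] and [K = q L].  Let [U] be a large vertex set.  If
for every [Y] in [U] with [|Y| >= |U| / K^d] fewer than [|U| / (2 D K^d)]
vertices of [U] have red density below [1 / K] into [Y], then a red copy of [H]
can be embedded greedily in [U].  Otherwise some [Y] and the set [X] of its
low-degree vertices form a sparse pair; recursively, [X] yields [q/2] sets of
size [4 n], most vertices of [Y] are sparse to each of them, and these vertices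
yield the remaining [q - q/2] sets.  Each level costs a factor [2 D K^d] on the
side of [X] but only [2 K^d] on the side of [Y], so a set [U] of size
[(2 K^d)^ceil(log q) D^floor(log q) 4 n] contains either a red copy of [H] or
[q] sets of size [4 n] that are pairwise sparse in red.  In the latter case [H]
is embedded greedily in blue, one set for each class of a proper colouring.
Since [q <= d + 1], the exponent [d] of [K = 8 q d^2 <= 16 d^3] leaves enough
room below [128 d^3] to absorb the rounding of [log q]. *)

Set Implicit Arguments.
Unset Strict Implicit.
Unset Printing Implicit Defensive.
Import Order.TTheory GRing.Theory Num.Theory.

(** * Greedy choice along an ordering *)

Definition has_copy (H : sgraph) (T : finType) (r : rel T) : Prop :=
  exists2 f : H -> T, injective f & forall x y, adj x y -> r (f x) (f y).

Definition update (n : nat) (T : Type) (g : 'I_n -> T) (i : 'I_n) (x : T) :=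
  fun k => if k == i then x else g k.

Lemma update_lt n T (g : 'I_n -> T) (i : 'I_n) x (k : 'I_n) :
  k < i -> update g i x k = g k.
Proof. by rewrite /update -val_eqE /= => ki; rewrite ltn_eqF. Qed.

Lemma update_eq n T (g : 'I_n -> T) (i : 'I_n) x : update g i x i = x.
Proof. by rewrite /update eqxx. Qed.

(** A partial map is kept as a total function: [P m] is meant to speak of its first [m] values, and
    [g0] supplies the others. *)
Lemma greedy n T (P : nat -> ('I_n -> T) -> Prop) (g0 : 'I_n -> T) :
  P 0 g0 ->
  (forall (i : 'I_n) g, P i g -> exists x, P i.+1 (update g i x)) ->
  exists g, P n g.
Proof.
move=> P0 Pstep.
suff H m : m <= n -> exists g, P m g by exact: H.
elim: m => [_|m IHm ltmn]; first by exists g0.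
have [g Pg] := IHm (ltnW ltmn).
have [x Px] := Pstep (Ordinal ltmn) g Pg.
by exists (update g (Ordinal ltmn) x).
Qed.

(** At step [i] only [i < n] values are taken, so among [n] admissible ones some value is fresh. *)
Lemma greedy_injective n (T : finType) (P : nat -> ('I_n -> T) -> Prop)
    (g0 : 'I_n -> T) :
  P 0 g0 ->
  (forall (i : 'I_n) g, P i g -> exists2 A : {set T}, n <= #|A| &
     forall x, x \in A -> P i.+1 (update g i x)) ->
  exists2 g, P n g & injective g.
Proof.
move=> P0 Pstep.
pose inj m (g : 'I_n -> T) :=
  forall j k : 'I_n, j < k -> k < m -> g j != g k.
have [||g [Pg injg]] := @greedy n T (fun m g => P m g /\ inj m g) g0.
- by split=> // j k _; rewrite ltn0.
- move=> i g [Pg injg]; have [A leA PA] := Pstep i g Pg.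
  have [x xA xN] : exists2 x, x \in A & x \notin [set g k | k : 'I_n & k < i].
    apply/subsetPn; apply/negP => /subset_leq_card leAi.
    have : #|[set g k | k : 'I_n & k < i]| <= i.
      apply: leq_trans (leq_imset_card _ _) _.
      rewrite -sum1_card (eq_bigl (fun k : 'I_n => k < i)) //; last first.
        by move=> k; rewrite inE.
      by rewrite -(big_ord_widen n (fun=> 1)) ?sum1_card ?card_ord // ltnW.
    by have := ltn_ord i; lia.
  exists x; split; first exact: PA.
  move=> j k ltjk; rewrite ltnS leq_eqVlt => /orP[/eqP ki|ki].
    have {}ki : k = i by apply: val_inj.
    rewrite ki update_eq update_lt -?ki //.
    apply: contraNneq xN => <-; apply/imsetP; exists j => //.
    by rewrite inE -ki.
  by rewrite !update_lt ?(ltn_trans ltjk) //; apply: injg.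
exists g => // j k gjk; apply: val_inj; case: (ltngtP j k) => // lt_.
  by have := injg _ _ lt_ (ltn_ord _); rewrite gjk eqxx.
by have := injg _ _ lt_ (ltn_ord _); rewrite gjk eqxx.
Qed.

(** * Greedy colouring and embedding of a degenerate graph *)

Section Embedding.
Variables (H : sgraph) (d D : nat) (v : 'I_#|H| -> H).
Hypothesis v_bij : bijective v.
Hypothesis back_degree : forall i : 'I_#|H|,
  #|[set j : 'I_#|H| | (j < i) && adj (v i) (v j)]| <= d.
Local Notation n := #|H|.

(** Each edge is checked when its later endpoint is placed, so a step only has to respect the edges
    back to positions [k < i]. *)
Lemma greedy_copy (T : finType) (r : rel T) (r_sym : symmetric r)
    (P : nat -> ('I_n -> T) -> Prop) (g0 : 'I_n -> T) :
  P 0 g0 ->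
  (forall (i : 'I_n) g, P i g -> exists2 A : {set T}, n <= #|A| &
     forall x, x \in A -> P i.+1 (update g i x) /\
       forall k : 'I_n, k < i -> adj (v i) (v k) -> r (g k) x) ->
  has_copy H r.
Proof.
move=> P0 Pstep.
pose edges m (g : 'I_n -> T) :=
  forall j k : 'I_n, j < k -> k < m -> adj (v k) (v j) -> r (g j) (g k).
have [||g [_ edg] injg] :=
    @greedy_injective n T (fun m g => P m g /\ edges m g) g0.
- by split=> // j k _; rewrite ltn0.
- move=> i g [Pg edg]; have [A leA PA] := Pstep i g Pg.
  exists A => // x /PA[Px rx]; split=> // j k ltjk.
  rewrite ltnS leq_eqVlt => /orP[/eqP ki|ki].
    have {}ki : k = i by apply: val_inj.
    rewrite ki update_eq update_lt -?ki // => kj.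
    by apply: rx; rewrite -?ki.
  by rewrite !update_lt ?(ltn_trans ltjk) //; apply: edg.
case: v_bij => w vK wK; exists (g \o w).
  exact: inj_comp injg (can_inj wK).
move=> x y; rewrite -{1}(wK x) -{1}(wK y) /=.
case: (ltngtP (w x) (w y)) => [lt_|lt_|/val_inj ->]; last by rewrite adj_irr.
  by rewrite adj_sym; apply: edg.
by rewrite r_sym; apply: edg.
Qed.

(** When colouring along [v], at most [d] of the [d + 1] colours occur on earlier neighbours. *)
Lemma chromatic_number_le : chromatic_number H <= d.+1.
Proof.
rewrite /chromatic_number; case: ex_minnP => q _; apply; apply/existsP.
pose proper m (g : 'I_n -> 'I_d.+1) :=
  forall j k : 'I_n, j < k -> k < m -> adj (v k) (v j) -> g j != g k.
have [||g prg] := @greedy n 'I_d.+1 proper (fun=> ord0).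
- by move=> j k _; rewrite ltn0.
- move=> i g prg.
  have [x _ xN] : exists2 x, x \in [set: 'I_d.+1] &
      x \notin [set g j | j in [set j : 'I_n | (j < i) && adj (v i) (v j)]].
    apply/subsetPn; apply/negP => /subset_leq_card.
    rewrite cardsT card_ord leqNgt ltnS => /negP; apply.
    exact: leq_trans (leq_imset_card _ _) (back_degree i).
  exists x => j k ltjk.
  rewrite ltnS leq_eqVlt => /orP[/eqP ki|ki].
    have {}ki : k = i by apply: val_inj.
    rewrite ki update_eq update_lt -?ki // => e_kj.
    apply: contraNneq xN => <-; apply: imset_f.
    by rewrite inE -ki ltjk.
  by rewrite !update_lt ?(ltn_trans ltjk) //; apply: prg.
case: v_bij => w vK wK; exists [ffun x => g (w x)].
apply/forallP => x; apply/forallP => y; apply/implyP; rewrite !ffunE.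
rewrite -{1}(wK x) -{1}(wK y).
case: (ltngtP (w x) (w y)) => [lt_|lt_|/val_inj ->]; last by rewrite adj_irr.
  by rewrite adj_sym; apply: prg.
by rewrite eq_sym; apply: prg.
Qed.

Lemma card_bigcup_le (I T : finType) (P : pred I) (F : I -> {set T}) :
  #|\bigcup_(i | P i) F i| <= \sum_(i | P i) #|F i|.
Proof.
elim/big_rec2: _ => [|i m A _ leAm]; first by rewrite cards0.
by apply: leq_trans (leq_card_setU _ _) _; rewrite leq_add2l.
Qed.

Definition low_degree (T : finType) (r : rel T) (k : nat) (U Y : {set T}) :=
  [set x in U | k * #|[set y in Y | r x y]| < #|Y|].

Hypothesis forward_sets : forall i : 'I_#|H|,
  #|[set nbhd (v j) :&: [set v k | k : 'I_#|H| & k <= i]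
         | j : 'I_#|H| & (i < j) && adj (v i) (v j)]| <= D.

(* The candidate set of an unembedded vertex [v l] depends only on its set of
   embedded neighbours, so only [D] low-degree sets have to be avoided. *)
Lemma dense_copy (T : finType) (r : rel T) (r_sym : symmetric r)
    (K : nat) (U : {set T}) :
  0 < n -> 0 < K -> 0 < D -> 2 * K ^ d * n <= #|U| ->
  (forall Y : {set T}, Y \subset U -> #|U| <= K ^ d * #|Y| ->
     2 * D * K ^ d * #|low_degree r K U Y| <= #|U|) ->
  has_copy H r.
Proof.
move=> n_gt0 K_gt0 D_gt0 leU low.
have Kd_gt0 : 0 < K ^ d by rewrite expn_gt0 K_gt0.
have /card_gt0P[x0 _] : 0 < #|U|.
  by apply: leq_trans leU; rewrite !muln_gt0 Kd_gt0.
pose cand m (g : 'I_n -> T) (S : {set H}) :=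
  [set x in U | [forall k : 'I_n, (k < m) && (v k \in S) ==> r (g k) x]].
pose back m (l : 'I_n) := [set k : 'I_n | (k < m) && adj (v l) (v k)].
(* Each embedded neighbour shrinks the candidate set of [v l] by a factor of at most [K]. *)
pose P m g := forall l : 'I_n, m <= l ->
  #|U| <= K ^ #|back m l| * #|cand m g (nbhd (v l))|.
have backd m (l : 'I_n) : m <= l -> #|back m l| <= d.
  move=> leml; apply: leq_trans (back_degree l); apply/subset_leq_card.
  by apply/subsetP => k; rewrite !inE => /andP[/leq_trans -> //].
have candd m g (l : 'I_n) : P m g -> m <= l ->
    #|U| <= K ^ d * #|cand m g (nbhd (v l))|.
  move=> Pg leml; apply: leq_trans (Pg l leml) _.
  by rewrite leq_mul2r leq_pexp2l ?backd ?orbT.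
apply: (@greedy_copy T r r_sym P (fun=> x0)).
  move=> l _; rewrite (_ : cand _ _ _ = U); last first.
    by apply/setP => x; rewrite inE; apply/andb_idr => _; apply/forallP.
  by rewrite leq_pmull // expn_gt0 K_gt0.
move=> i g Pg.
pose fam := [set nbhd (v j) :&: [set v k | k : 'I_n & k <= i]
         | j : 'I_n & (i < j) && adj (v i) (v j)].
pose bad := \bigcup_(S in fam) low_degree r K U (cand i g S).
(* [cand i] reads only positions below [i], so cutting [nbhd (v l)] down to the first [i.+1]
   positions changes nothing. *)
have candS l : cand i g (nbhd (v l) :&: [set v k | k : 'I_n & k <= i]) =
    cand i g (nbhd (v l)).
  apply/setP => x; rewrite !inE; congr (_ && _); apply: eq_forallb => k.
  rewrite !inE; case: ltnP => //= ltki; rewrite [X in _ && X](_ : _ = true) ?andbT //.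
  by apply: imset_f; rewrite inE ltnW.
have card_bad : 2 * K ^ d * #|bad| <= #|U|.
  rewrite -(@leq_pmul2l D) //.
  apply: (@leq_trans (\sum_(S in fam) #|U|)); last first.
    by rewrite sum_nat_const leq_mul2r forward_sets orbT.
  apply: (@leq_trans (\sum_(S in fam)
      2 * D * K ^ d * #|low_degree r K U (cand i g S)|)).
    rewrite -big_distrr /= mulnA (mulnCA D 2) mulnA leq_mul2l card_bigcup_le.
    by rewrite orbT.
  apply: leq_sum => S /imsetP[l]; rewrite inE => /andP[ltil _] ->.
  rewrite candS; apply: low; last exact: candd (ltnW ltil).
  by apply/subsetP => x; rewrite inE => /andP[].
(* There are at least [|U| / K^d] candidates for [v i] and at most [|U| / (2 K^d)] bad vertices, so
   at least [|U| / (2 K^d) >= n] choices survive. *)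
exists (cand i g (nbhd (v i)) :\: bad).
  have := candd i g i Pg (leqnn _); have := cardsID bad (cand i g (nbhd (v i))).
  have : #|cand i g (nbhd (v i)) :&: bad| <= #|bad| by rewrite subset_leq_card ?subsetIr.
  move: leU card_bad Kd_gt0; move: (K ^ d) => E; nia.
move=> x; rewrite !inE => /and3P[xNbad xU /forallP/= rx]; split; last first.
  by move=> k ki ik; have := rx k; rewrite ki inE ik.
move=> l ltil.
have backS : #|back i.+1 l| = adj (v l) (v i) + #|back i l|.
  rewrite (cardsD1 i) !inE leqnn /=; congr (_ + _); apply: eq_card => k.
  by rewrite !inE ltnS (leq_eqVlt k i) val_eqE; case: eqVneq => //= ->; rewrite ltnn.
have candE : cand i.+1 (update g i x) (nbhd (v l)) =
    if adj (v l) (v i) then [set y in cand i g (nbhd (v l)) | r x y]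
    else cand i g (nbhd (v l)).
  apply/setP => y; rewrite (fun_if (fun A : {set T} => y \in A)) !inE.
  case: (y \in U); rewrite /= ?if_same //.
  apply/forallP/idP => /= [rall|].
    have rlt : [forall k : 'I_n, (k < i) && (v k \in nbhd (v l)) ==> r (g k) y].
      apply/forallP => k; apply/implyP => /andP[ltki kl].
      by have := rall k; rewrite update_lt // kl ltnS ltnW.
    rewrite rlt; case: ifP => // il.
    by have := rall i; rewrite update_eq !inE ltnSn il.
  case: ifP => il => [/andP[/forallP rall rxy]|/forallP rall] k;
    have := rall k; rewrite ltnS (leq_eqVlt k) val_eqE;
    case: eqVneq => [->|ne] /=; rewrite ?update_eq ?inE ?il ?rxy ?implybT //;
    by rewrite /update (negbTE ne).
rewrite backS candE; case: ifP => il; last exact: Pg (ltnW ltil).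
rewrite expnS -mulnA mulnCA.
apply: leq_trans (Pg l (ltnW ltil)) _; rewrite leq_mul2l; apply/orP; right.
rewrite leqNgt; apply/negP => lowx; move/negP: xNbad; apply.
apply/bigcupP; exists (nbhd (v l) :&: [set v k | k : 'I_n & k <= i]).
  by apply: imset_f; rewrite inE ltil adj_sym.
by rewrite inE xU candS.
Qed.

End Embedding.

Lemma subset_of_card (T : finType) (U : {set T}) m :
  m <= #|U| -> exists2 A : {set T}, A \subset U & #|A| = m.
Proof.
move=> lemU; exists [set x in take m (enum U)].
  by apply/subsetP => x; rewrite inE => /mem_take; rewrite mem_enum.
rewrite cardsE (card_uniqP _) ?take_uniq ?enum_uniq //.
by rewrite size_take -cardE; case: ltngtP lemU.
Qed.

(** * One-sided sparseness and double counting *)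

Section Sparse.
Variables (T : finType) (r : rel T).
Hypothesis r_sym : symmetric r.

Definition sparse k (A B : {set T}) :=
  [forall x in A, k * #|[set y in B | r x y]| <= #|B|].

(** Double counting of red edges: there are at most [|A| |B| / k] of them, and each [y] counted here
    has more than [|A| / l] red neighbours in [A]. *)
Lemma sparse_converse k l (A B : {set T}) : sparse k A B ->
  k * #|[set y in B | #|A| < l * #|[set x in A | r y x]|]| <= l * #|B|.
Proof.
move=> /forall_inP spAB; set bad := [set _ in _ | _].
have [A0|[x0 x0A]] := set_0Vmem A.
  rewrite (_ : bad = set0) ?cards0 ?muln0 //; apply/setP => y; rewrite !inE.
  rewrite A0 (_ : [set _ in _ | _] = set0) ?cards0 ?muln0 ?andbF //.
  by apply/setP => x; rewrite !inE.
have A_gt0 : 0 < #|A| by apply/card_gt0P; exists x0.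
have count : \sum_(y in B) #|[set x in A | r y x]| =
    \sum_(x in A) #|[set y in B | r x y]|.
  under eq_bigr => y _ do rewrite -sum1_card.
  under [RHS]eq_bigr => x _ do rewrite -sum1_card.
  rewrite (exchange_big_dep (mem A)) /=; last by move=> y x _; rewrite inE => /andP[].
  apply: eq_bigr => x xA; apply: eq_bigl => y.
  by rewrite !inE xA r_sym.
rewrite -(leq_pmul2r A_gt0).
apply: (@leq_trans (k * (l * \sum_(y in B) #|[set x in A | r y x]|))).
  rewrite -mulnA leq_mul2l; apply/orP; right.
  rewrite -sum_nat_const big_distrr /=.
  rewrite [X in _ <= X](bigID (mem bad)) /=.
  apply: leq_trans (leq_addr _ _).
  rewrite [X in _ <= X](eq_bigl (mem bad)); last first.
    by move=> y; rewrite /= !inE; case: (y \in B).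
  by apply: leq_sum => y; rewrite inE => /andP[_ /ltnW].
rewrite count mulnCA -mulnA leq_mul2l; apply/orP; right.
rewrite big_distrr /= mulnC -sum_nat_const; exact: leq_sum.
Qed.

End Sparse.

(** * Size of the host set through the recursion *)

(** Every level costs [2 K^d], and there are at most [up_log 2 q] levels; [D] is lost only in steps
    to [q./2], of which there are at most [trunc_log 2 q]. *)
Definition ramsey_bound K d D m q := (2 * K ^ d) ^ up_log 2 q * D ^ trunc_log 2 q * m.

(** Passing to [q./2] lowers [trunc_log] by exactly one and [up_log] by at least one. *)
Lemma ramsey_bound_half K d D m q : 1 < q -> 0 < K -> 0 < D ->
  2 * D * K ^ d * ramsey_bound K d D m q./2 <= ramsey_bound K d D m q.
Proof.
move=> q_gt1 K_gt0 D_gt0; rewrite /ramsey_bound (trunc_log2S q_gt1).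
have : (up_log 2 q./2).+1 <= up_log 2 q.
  by rewrite -up_log2_double ?half_gt0 // leq_up_log // -{2}(odd_double_half q) leq_addl.
have E0 : 0 < 2 * K ^ d by rewrite muln_gt0 expn_gt0 K_gt0.
move/(leq_pexp2l E0) => leE; rewrite (expnS D).
apply: leq_trans (_ : (2 * K ^ d) ^ (up_log 2 q./2).+1 * (D * D ^ trunc_log 2 q./2) * m <= _).
  by rewrite expnS; lia.
by rewrite !leq_mul2r leE !orbT.
Qed.

(** Passing to [uphalf q] lowers [up_log] by exactly one and does not raise [trunc_log]. *)
Lemma ramsey_bound_uphalf K d D m q : 1 < q -> 0 < K -> 0 < D ->
  2 * K ^ d * ramsey_bound K d D m (uphalf q) <= ramsey_bound K d D m q.
Proof.
move=> q_gt1 K_gt0 D_gt0; rewrite /ramsey_bound.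
have -> : up_log 2 q = (up_log 2 (uphalf q)).+1.
  by case: q q_gt1 => [//|[//|q]] _; rewrite up_log2S.
rewrite expnS -!mulnA !leq_mul2l; apply/orP; right; apply/orP; right.
apply/orP; right; rewrite leq_mul2r leq_pexp2l ?orbT // leq_trunc_log //.
by rewrite uphalf_half; have := odd_double_half q; lia.
Qed.

(** * A red copy or a sparse family, and the blue embedding *)

Section Main.
Variables (H : sgraph) (d D : nat) (v : 'I_#|H| -> H).
Hypothesis v_bij : bijective v.
Hypothesis back_degree : forall i : 'I_#|H|,
  #|[set j : 'I_#|H| | (j < i) && adj (v i) (v j)]| <= d.
Hypothesis forward_sets : forall i : 'I_#|H|,
  #|[set nbhd (v j) :&: [set v k | k : 'I_#|H| & k <= i]
         | j : 'I_#|H| & (i < j) && adj (v i) (v j)]| <= D.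

(** Sparseness is found at strength [K] and kept at the weaker [L]: with [q * L <= K], at most half
    of [Y] has to be discarded. *)
Lemma sparse_family_or_copy (T : finType) (r : rel T) (r_sym : symmetric r)
    (K L m q : nat) (U : {set T}) :
  0 < q -> 0 < K -> 0 < D -> 0 < #|H| <= m -> q * L <= K ->
  ramsey_bound K d D m q <= #|U| ->
  has_copy H r \/
  exists s : seq {set T}, [/\ size s = q,
    forall A, A \in s -> A \subset U /\ #|A| = m & pairwise (sparse r L) s].
Proof.
move=> q_gt0 K_gt0 D_gt0 /andP[H_gt0 Hm].
elim/ltn_ind: q q_gt0 U => q IHq q_gt0 U qL leU.
have [q_le1|q_gt1] := leqP q 1.
  have q1 : q = 1 by lia.
  right; have [|A AU Am] := @subset_of_card T U m.
    by move: leU; rewrite q1 /ramsey_bound up_log1 trunc_log1 !expn0 !mul1n.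
  by exists [:: A]; split=> // B; rewrite inE => /eqP ->.
(* [P Y] says that [Y] violates the hypothesis of [dense_copy]. *)
pose P (Y : {set T}) := [&& Y \subset U, #|U| <= K ^ d * #|Y| &
  #|U| < 2 * D * K ^ d * #|low_degree r K U Y|].
case: (pickP P) => [Y /and3P[YU leY ltX]|noY]; last first.
  left; apply: (dense_copy v_bij back_degree forward_sets r_sym H_gt0 K_gt0 D_gt0).
    apply: leq_trans (leq_trans (ramsey_bound_uphalf d m q_gt1 K_gt0 D_gt0) leU).
    rewrite leq_mul2l (leq_trans Hm) ?orbT // /ramsey_bound leq_pmull //.
    by rewrite muln_gt0 !expn_gt0 D_gt0 muln_gt0 expn_gt0 K_gt0.
  move=> Y YU leY; rewrite leqNgt; apply/negP => ltX.
  by have := noY Y; rewrite /P YU leY ltX.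
set X := low_degree r K U Y in ltX.
have E0 : 0 < K ^ d by rewrite expn_gt0 K_gt0.
have half_lt : q./2 < q by have := odd_double_half q; lia.
have leX : ramsey_bound K d D m q./2 <= #|X|.
  have DE : 0 < 2 * D * K ^ d by rewrite !muln_gt0 D_gt0.
  rewrite -(leq_pmul2l DE).
  apply: leq_trans (ramsey_bound_half d m q_gt1 K_gt0 D_gt0) _.
  exact: leq_trans leU (ltnW ltX).
have q2_gt0 : 0 < q./2 by rewrite half_gt0.
have [|copy|[sX [sizeX subX spX]]] := IHq _ half_lt q2_gt0 X _ leX;
  [by apply: leq_trans qL; rewrite leq_mul2r ltnW ?orbT | by left |].
pose bad := \bigcup_(B <- sX) [set y in Y | #|B| < L * #|[set x in B | r y x]|].
have spXY B : B \in sX -> sparse r K B Y.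
  move=> /subX[/subsetP BX _]; apply/forall_inP => x /BX.
  by rewrite inE => /andP[_ /ltnW].
(* By [sparse_converse], each of the [q./2] sets spoils at most [L |Y| / K] vertices of [Y]. *)
have card_bad : K * #|bad| <= q./2 * (L * #|Y|).
  rewrite -sizeX /bad; elim: (sX) spXY => [|B s IHs] spXY.
    by rewrite big_nil cards0 muln0.
  rewrite big_cons /= mulSn.
  apply: leq_trans (leq_add (sparse_converse r_sym L (spXY B (mem_head _ _))) (IHs _)).
    by rewrite -mulnDr leq_mul2l leq_card_setU orbT.
  by move=> C Cs; apply: spXY; rewrite inE Cs orbT.
have le_bad : 2 * #|bad| <= #|Y|.
  rewrite -(leq_pmul2l K_gt0) mulnCA.
  apply: leq_trans (_ : q * L * #|Y| <= _); last by rewrite leq_mul2r qL orbT.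
  apply: leq_trans (_ : 2 * q./2 * (L * #|Y|) <= _).
    by rewrite -mulnA leq_mul2l card_bad.
  by rewrite -(mulnA q) leq_mul2r -{2}(odd_double_half q) mul2n leq_addl orbT.
have leY' : #|Y| <= 2 * #|Y :\: bad|.
  have := cardsID bad Y.
  have : #|Y :&: bad| <= #|bad| by rewrite subset_leq_card ?subsetIr.
  by lia.
have leUY : ramsey_bound K d D m (uphalf q) <= #|Y :\: bad|.
  have DE : 0 < 2 * K ^ d by rewrite !muln_gt0.
  rewrite -(leq_pmul2l DE).
  apply: leq_trans (ramsey_bound_uphalf d m q_gt1 K_gt0 D_gt0) _.
  apply: leq_trans leU (leq_trans leY _).
  by rewrite (mulnC 2) -mulnA leq_mul2l leY' orbT.
have uphalf_lt : uphalf q < q by rewrite uphalf_half; have := odd_double_half q; lia.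
have qY_gt0 : 0 < uphalf q by rewrite uphalf_half; lia.
have [|copy|[sY [sizeY subY spY]]] := IHq _ uphalf_lt qY_gt0 (Y :\: bad) _ leUY;
  [by apply: leq_trans qL; rewrite leq_mul2r ltnW ?orbT | by left |].
(* [sY] comes first: removing [bad] bounds red degrees from [Y] into the sets inside [X], and
   [pairwise] asks for sparseness from earlier sets to later ones. *)
right; exists (sY ++ sX); split.
- by rewrite size_cat sizeX sizeY uphalf_half; have := odd_double_half q; lia.
- move=> A; rewrite mem_cat => /orP[/subY|/subX] [sub cA]; split=> //.
    by apply: subset_trans sub (subset_trans (subsetDl _ _) YU).
  by apply: subset_trans sub _; apply/subsetP => x; rewrite inE => /andP[].
rewrite pairwise_cat spX spY !andbT; apply/allrelP => A B As Bs.
apply/forall_inP => y yA; have /subsetP/(_ y yA) := (subY A As).1.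
rewrite inE => /andP[yNbad yY]; rewrite leqNgt; apply: contra yNbad => bad_y.
by rewrite /bad (big_rem B) //= inE inE yY bad_y.
Qed.

(** Of the [4 n] vertices of a set, at most [n] are dropped for having many red neighbours in
    another set and at most [2 n] are red neighbours of embedded neighbours; the remaining [n]
    suffice for the greedy choice. *)
Lemma sparse_family_copy (T : finType) (r : rel T) (r_sym : symmetric r)
    (s : seq {set T}) :
  0 < #|H| -> 0 < d -> size s = chromatic_number H ->
  (forall A, A \in s -> #|A| = 4 * #|H|) ->
  pairwise (sparse r (8 * (d * d))) s ->
  has_copy H (fun x y => ~~ r x y).
Proof.
move=> H_gt0 d_gt0; have := chromatic_number_le v_bij back_degree.
rewrite /chromatic_number; case: ex_minnP => q /existsP[c /forallP col] _.
move=> qd sizes cards sp.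
pose S (a : 'I_q) := nth set0 s a.
have Ss (a : 'I_q) : S a \in s by apply: mem_nth; rewrite sizes.
have cardS a : #|S a| = 4 * #|H| by apply: cards.
have spS (a b : 'I_q) : a < b -> sparse r (8 * (d * d)) (S a) (S b).
  by move=> ltab; have /(pairwiseP set0)/(_ a b) := sp; apply; rewrite ?inE ?sizes.
pose bad a b := [set x in S b | 4 * #|H| < 2 * d * #|[set y in S a | r x y]|].
(* Sparseness [8 d^2] against the threshold [2 d] gives at most [n / d] bad vertices; if [b < a],
   sparseness runs from [S b] to [S a] and there are none. *)
have card_bad a b : a != b -> 8 * (d * d) * #|bad a b| <= 2 * d * (4 * #|H|).
  case: (ltngtP a b) => [lt_ _|lt_ _|/val_inj ->]; last by rewrite eqxx.
    have := sparse_converse r_sym (2 * d) (spS a b lt_).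
    by rewrite !cardS.
  rewrite (_ : bad a b = set0) ?cards0 ?muln0 //; apply/setP => x; rewrite !inE.
  apply/negbTE; rewrite negb_and -leqNgt -implybE; apply/implyP => xb.
  have /forall_inP/(_ x xb) := spS b a lt_; rewrite cardS.
  by apply: leq_trans; rewrite leq_mul2r; apply/orP; right; nia.
pose good b := S b :\: \bigcup_(a | a != b) bad a b.
have card_good b : 3 * #|H| <= #|good b|.
  have le_bad : 8 * (d * d) * #|\bigcup_(a | a != b) bad a b| <= d * (2 * d * (4 * #|H|)).
    apply: leq_trans (_ : \sum_(a | a != b) 8 * (d * d) * #|bad a b| <= _).
      by rewrite -big_distrr /= leq_mul2l card_bigcup_le orbT.
    apply: leq_trans (_ : \sum_(a : 'I_q | a != b) 2 * d * (4 * #|H|) <= _).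
      by apply: leq_sum => a; exact: card_bad.
    (* There are [q - 1 <= d] other classes. *)
    rewrite sum_nat_const leq_mul2r; apply/orP; right.
    by have := cardC1 b; rewrite card_ord => ->; lia.
  have := cardsID (\bigcup_(a | a != b) bad a b) (S b).
  have : #|S b :&: \bigcup_(a | a != b) bad a b| <= #|\bigcup_(a | a != b) bad a b|.
    by rewrite subset_leq_card ?subsetIr.
  rewrite cardS -/(good b) => le1 eq1.
  have : #|\bigcup_(a | a != b) bad a b| <= #|H|.
    by rewrite -(@leq_pmul2l (8 * (d * d))) ?muln_gt0 ?d_gt0 //; lia.
  by lia.
have /card_gt0P[x0 _] : 0 < #|T|.
  have /card_gt0P[h _] := H_gt0.
  by apply: leq_trans (max_card (good (c h))); have := card_good (c h); lia.
pose P m (g : 'I_#|H| -> T) := forall k : 'I_#|H|, k < m -> g k \in good (c (v k)).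
have nr_sym : symmetric (fun x y => ~~ r x y) by move=> x y /=; rewrite r_sym.
apply: (greedy_copy v_bij nr_sym (P := P) (g0 := fun=> x0)).
  by move=> k; rewrite ltn0.
move=> i g Pg.
pose back := [set k : 'I_#|H| | (k < i) && adj (v i) (v k)].
pose red := \bigcup_(k in back) [set y in S (c (v i)) | r (g k) y].
have le_red : #|red| <= 2 * #|H|.
  rewrite -(@leq_pmul2l (2 * d)) ?muln_gt0 ?d_gt0 //.
  apply: leq_trans (_ : d * (4 * #|H|) <= _); last by lia.
  apply: leq_trans (_ : \sum_(k in back) 4 * #|H| <= _); last first.
    by rewrite sum_nat_const leq_mul2r back_degree orbT.
  apply: leq_trans (_ : \sum_(k in back) 2 * d * #|[set y in S (c (v i)) | r (g k) y]| <= _).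
    by rewrite -big_distrr /= leq_mul2l card_bigcup_le orbT.
  (* [g k] avoids [bad a (c (v k))] for every other colour [a], in particular for [c (v i)], so it
     has at most [4 n / (2 d)] red neighbours in that set. *)
  apply: leq_sum => k; rewrite inE => /andP[ltki ik].
  have := Pg k ltki; rewrite inE => /andP[gN gS].
  rewrite leqNgt; apply: contra gN => badk; apply/bigcupP; exists (c (v i)).
    by have /forallP/(_ (v k))/implyP := col (v i); apply.
  by rewrite inE gS.
exists (good (c (v i)) :\: red).
  have := cardsID red (good (c (v i))); have := card_good (c (v i)).
  have : #|good (c (v i)) :&: red| <= #|red| by rewrite subset_leq_card ?subsetIr.
  by lia.
move=> x /setDP[xgood xNred]; split.
  move=> k; rewrite ltnS leq_eqVlt => /orP[/eqP ki|ki].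
    have -> : k = i by apply: val_inj.
    by rewrite update_eq.
  by rewrite update_lt //; apply: Pg.
move=> k ki ik; apply: contra xNred => rx; apply/bigcupP; exists k.
  by rewrite inE ki.
by move: xgood; rewrite !inE rx andbT => /andP[].
Qed.

End Main.

(** * Comparison of the recursive bound with the stated one *)

Local Open Scope ring_scope.

(* With [x = log d], [y = log q] and [k] the ceiling of [y], this is the logarithm
   of [(8 d^2 q)^k <= (128 d^3)^(log q)].  The ratio [k / y] is worst for [q]
   just above a power of 2, and the slack is tight enough that [k <= 3] needs
   the lower bounds on [y] coming from [q >= 2], [q >= 3] and [q >= 5]. *)
Lemma up_log_key (R : realFieldType) (k : nat) (x y : R) :
  (0 < k)%N -> k.-1%:R <= x -> k.-1%:R <= y ->
  (k = 1%N -> 1 <= y) -> (k = 2%N -> 3 <= 2 * y) -> (k = 3%N -> 9 <= 4 * y) ->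
  k%:R * (3 + 2 * x + y) <= (7 + 3 * x) * y.
Proof.
case: k => [//|[|[|[|k]]]] _ /= hx hy h1 h2 h3.
- by have := h1 erefl; nra.
- by have := h2 erefl; nra.
- by have := h3 erefl; nra.
have -> : k.+4%:R = k%:R + 4 :> R by rewrite -addn4 natrD.
have : 0 <= k%:R :> R by [].
rewrite -addn3 natrD in hx hy; move: (k%:R) hx hy => t hx hy ht.
rewrite -subr_ge0.
(* Here [t + 3] is the ceiling minus one, so [x - (t + 3)] and [y - (t + 3)] are nonnegative and
   every summand is visibly nonnegative. *)
have -> : (7 + 3 * x) * y - (t + 4) * (3 + 2 * x + y) =
  (y - (t + 3)) * (6 + 3 * x - (t + 3)) + (x - (t + 3)) * (t + 1) + t by ring.
by rewrite !addr_ge0 ?mulr_ge0 //; lra.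
Qed.

(** In base 2 logarithms, right side minus left side is a sum of four nonnegative terms: [d] times
    the slack of [up_log_key], the rounding of the exponent of [D], the [2] in [3 d + 2], and the
    [8] in [7 d + 8], which pays for the factor [2] of each level and for the [4] of [4 n]. *)
Lemma bound_le (R : realType) (n d D q : nat) :
  (1 < q)%N -> (q <= d.+1)%N -> (0 < D)%N ->
  ((2 * (q * (8 * (d * d))) ^ d) ^ up_log 2 q * D ^ trunc_log 2 q * (4 * n))%:R
   <= (2 ^+ (7 * d + 8) * d%:R ^+ (3 * d + 2) * D%:R) `^ (log2 (R := R) q%:R)
        * n%:R :> R.
Proof.
move=> q_gt1 qd D_gt0.
have d_gt0 : (0 < d)%N by rewrite -ltnS (leq_trans _ qd).
have q_gt0 : (0 < q)%N by apply: ltnW.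
rewrite mulnA [X in X <= _]natrM ler_wpM2r //.
have l2 : 0 < ln 2 :> R by apply: ln_gt0; rewrite ltr1n.
have lgX (a b : nat) : ln ((a.+1 ^ b)%:R : R) = b%:R * ln a.+1%:R.
  by rewrite natrX lnXn ?ltr0n // mulr_natl.
have lg_ge (a b c : nat) : (0 < a)%N -> (2 ^ b <= a ^ c)%N ->
   b%:R * ln 2 <= c%:R * ln a%:R :> R.
  case: a => // a _ leab; rewrite -!lgX ler_ln ?posrE ?ltr0n ?expn_gt0 //.
  by rewrite ler_nat.
set k := up_log 2 q; set l := trunc_log 2 q.
have /andP[kq _] : (2 ^ k.-1 < q <= 2 ^ k)%N by apply: up_log_bounds.
have lq : (2 ^ l <= q)%N by have /andP[] := @trunc_log_bounds 2 q isT q_gt0.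
have k_gt0 : (0 < k)%N by rewrite up_log_gt0.
set L := log2 _; set x : R := log2 d%:R.
have L_ge c b : (0 < c)%N -> (2 ^ b <= q ^ c)%N -> b%:R <= c%:R * L.
  move=> c0 /lg_ge => /(_ q_gt0); rewrite /L /log2 mulrA ler_pdivlMr //.
have lL : l%:R <= L by have := L_ge 1%N l isT; rewrite expn1 mul1r; apply.
have kL : k.-1%:R <= L by have := L_ge 1%N k.-1 isT; rewrite expn1 mul1r; apply; rewrite ltnW.
have L1 : 1 <= L by have := L_ge 1%N 1%N isT; rewrite expn1 mul1r; apply.
have x0 : 0 <= x by rewrite divr_ge0 ?ln_ge0 ?ler1n // ltW.
(* [2^(k-1) < q <= d + 1] gives [2^(k-1) <= d]. *)
have kx : k.-1%:R <= x.
  have := @lg_ge d k.-1 1%N d_gt0; rewrite expn1 mul1r /x /log2 ler_pdivlMr //.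
  by apply; rewrite -ltnS (leq_trans kq).
have key : k%:R * (3 + 2 * x + L) <= (7 + 3 * x) * L.
  (* If [k = 2] then [q >= 3], and [2^3 <= 3^2]; if [k = 3] then [q >= 5], and [2^9 <= 5^4]. *)
  apply: up_log_key => //.
  - move=> k2; rewrite -/L; have /= := @L_ge 2%N 3%N isT; apply.
    by apply: leq_trans (_ : 3 ^ 2 <= _)%N; rewrite // leq_exp2r //; move: kq; rewrite k2.
  - move=> k3; have := @L_ge 4%N 9%N isT; apply.
    by apply: leq_trans (_ : 5 ^ 4 <= _)%N; rewrite // leq_exp2r //; move: kq; rewrite k3.
have y0 : 0 <= log2 D%:R :> R by rewrite divr_ge0 ?ln_ge0 ?ler1n // ltW.
set y := log2 _ in y0.
have lnE (z : R) : ln z = log2 z * ln 2 by rewrite /log2 divfK // gt_eqF.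
have pos (a : nat) : (0 < a)%N -> a%:R \is @Num.pos R by rewrite posrE ltr0n.
have lnMn (a b : nat) : (0 < a)%N -> (0 < b)%N ->
    ln (a * b)%:R = ln a%:R + ln b%:R :> R.
  by move=> a0 b0; rewrite natrM lnM ?pos.
have lnXn' (a b : nat) : (0 < a)%N -> ln (a ^ b)%:R = b%:R * ln a%:R :> R.
  by case: a => // a _; rewrite lgX.
rewrite -natrX -natrX -!natrM /powR.
have C_gt0 : (0 < 2 ^ (7 * d + 8) * d ^ (3 * d + 2) * D)%N.
  by rewrite !muln_gt0 !expn_gt0 d_gt0 D_gt0.
rewrite gt_eqF ?ltr0n //.
have ln8 : ln 8%:R = 3 * ln 2 :> R by rewrite -(lnXn' 2 3).
have ln4 : ln 4%:R = 2 * ln 2 :> R by rewrite -(lnXn' 2 2).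
rewrite -[X in X <= _]lnK ?pos //; last first.
  by rewrite !(muln_gt0, expn_gt0) q_gt0 d_gt0 D_gt0.
rewrite ler_expR !(lnMn, lnXn') ?(muln_gt0, expn_gt0, q_gt0, d_gt0, D_gt0) //.
rewrite ln8 ln4 (lnE d%:R) (lnE q%:R) (lnE D%:R) -/x -/L -/y.
rewrite (natrD _ (7 * d)) (natrD _ (3 * d)) !natrM.
have k1 : k%:R <= L + 1 by rewrite -(prednK k_gt0) -natr1 lerD2r.
set d' : R := d%:R.
have d'0 : 0 <= d' by [].
have ly : l%:R * y <= L * y by rewrite ler_wpM2r.
have dkey := ler_wpM2l d'0 key.
have Lx : 0 <= L * x by rewrite mulr_ge0 // (le_trans _ L1).
rewrite -subr_ge0.
match goal with |- is_true (0 <= ?e) => have -> : e = ln 2 *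
  ((d' * ((7 + 3 * x) * L) - d' * (k%:R * (3 + 2 * x + L))) + (L * y - l%:R * y)
   + 2 * (L * x) + (8 * L - k%:R - 2)) by ring end.
rewrite mulr_ge0 ?(ltW l2) //; lra.
Qed.

(* Passage to Ramsey numbers *)
Local Close Scope ring_scope.

Lemma ramsey_number_le (H : sgraph) (N : nat) : 0 < N ->
  (forall r : rel 'I_N, symmetric r ->
     has_copy H r \/ has_copy H (fun x y => ~~ r x y)) ->
  ramsey_number H <= N.
Proof.
move=> N_gt0 copy; rewrite /ramsey_number; case: ex_minnP => M _; apply.
rewrite N_gt0; apply/forallP => c.
have r_sym : symmetric (fun x y : 'I_N => c [set x; y]).
  by move=> x y; rewrite setUC.
have [[f injf adjf]|[f injf adjf]] := copy _ r_sym;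
  apply/existsP; exists (finfun f); apply/existsP; [exists true|exists false];
  apply/andP; split; try (by apply/injectiveP => x y; rewrite !ffunE => /injf);
  apply/forallP => x; apply/forallP => y; apply/implyP => /adjf; rewrite !ffunE.
  by move=> ->.
by move/negbTE => ->.
Qed.

Lemma chromatic_number_gt0 (H : sgraph) : 0 < #|H| -> 0 < chromatic_number H.
Proof.
move=> /card_gt0P[x _]; rewrite /chromatic_number.
by case: ex_minnP => -[|//] /existsP[f _] _; case: (f x).
Qed.

Lemma chromatic_number1 (H : sgraph) :
  chromatic_number H = 1 -> forall x y : H, ~~ adj x y.
Proof.
rewrite /chromatic_number; case: ex_minnP => q /existsP[f /forallP col] _ q1 x y.
subst q; have /forallP/(_ y) := col x.
by rewrite (ord1 (f x)) (ord1 (f y)) eqxx implybF.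
Qed.

Lemma chromatic_number_gt1 (H : sgraph) :
  1 < chromatic_number H -> exists x y : H, adj x y.
Proof.
rewrite /chromatic_number; case: ex_minnP => q _ minq q_gt1.
have [/existsP[x /existsP[y xy]]|no_edge] :=
  boolP [exists x : H, exists y : H, adj x y]; first by exists x, y.
suff /minq : colorable H 1 by rewrite leqNgt q_gt1.
apply/existsP; exists [ffun=> ord0]; apply/forallP => x; apply/forallP => y.
apply/implyP => xy; case/negP: no_edge.
by apply/existsP; exists x; apply/existsP; exists y.
Qed.

(** [sparse_family_copy] dictates [L = 8 d^2] and [m = 4 n]; [K = q L] is the least value that
    [sparse_family_or_copy] admits. *)
Lemma ramsey_number_le_bound (H : sgraph) (d D : nat) :
  0 < #|H| -> 0 < d -> 0 < D -> degenerate d D H ->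
  ramsey_number H <=
    ramsey_bound (chromatic_number H * (8 * (d * d))) d D (4 * #|H|)
      (chromatic_number H).
Proof.
move=> H_gt0 d_gt0 D_gt0 [v v_bij deg].
have back_degree i := (deg i).1; have forward_sets i := (deg i).2.
set q := chromatic_number H; set K := q * _.
have q_gt0 : 0 < q by apply: chromatic_number_gt0.
have K_gt0 : 0 < K by rewrite !muln_gt0 q_gt0 d_gt0.
have m_ge : 0 < #|H| <= 4 * #|H| by rewrite H_gt0 leq_pmull.
apply: ramsey_number_le => [|r r_sym].
  by rewrite !muln_gt0 !expn_gt0 muln_gt0 expn_gt0 K_gt0 D_gt0 H_gt0.
have [|copy|[s [sizes subs sps]]] := sparse_family_or_copy v_bij back_degree forward_sets
    r_sym q_gt0 K_gt0 D_gt0 m_ge (leqnn K) (U := setT).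
- by rewrite cardsT card_ord.
- by left.
- right; apply: (sparse_family_copy v_bij back_degree r_sym H_gt0 d_gt0 sizes) => //.
  by move=> A /subs[].
Qed.

(** The earlier end of an edge is a back neighbour of the later one, and the later end contributes a
    set counted by [D] at the earlier one. *)
Lemma degenerate_edge_gt0 (H : sgraph) (d D : nat) (x y : H) :
  degenerate d D H -> adj x y -> (0 < d) && (0 < D).
Proof.
move=> [v [w vK wK] deg].
wlog ltxy : x y / w x < w y => [wlog_lt xy|xy].
  case: (ltngtP (w x) (w y)) => [lt_|lt_|/val_inj eqw].
  - exact: wlog_lt lt_ xy.
  - by apply: wlog_lt lt_ _; rewrite adj_sym.
  - by rewrite -(wK x) -(wK y) eqw adj_irr in xy.
apply/andP; split.
  apply: leq_trans (deg (w y)).1; apply/card_gt0P; exists (w x).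
  by rewrite inE ltxy !wK adj_sym.
apply: leq_trans (deg (w x)).2; apply/card_gt0P.
by eexists; apply: imset_f; rewrite inE; apply/andP; split; [exact: ltxy|rewrite !wK].
Qed.

Local Open Scope ring_scope.

Theorem theorem3p1 (R : realType) (H : sgraph) (d D : nat)
  (H_nonempty : (0 < #|H|)%N) (H_degenerate : degenerate d D H) :
  (ramsey_number H)%:R <=
    (2 ^+ (7 * d + 8) * d%:R ^+ (3 * d + 2) * D%:R)
      `^ (log2 (R := R) (chromatic_number H)%:R) * #|H|%:R.
Proof.
have q_gt0 := chromatic_number_gt0 H_nonempty.
(* For [q = 1] there are no edges, the exponent [log q] vanishes, and any injection into [n] points
   is a copy. This covers [d = 0] and [D = 0]. *)
have [q_le1|q_gt1] := leqP (chromatic_number H) 1.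
  have q1 : chromatic_number H = 1%N by apply/eqP; rewrite eqn_leq q_le1.
  have no_edge := chromatic_number1 q1.
  rewrite q1 /log2 ln1 mul0r powRr0 mul1r ler_nat.
  apply: ramsey_number_le => // r _; left; exists enum_rank.
    exact: enum_rank_inj.
  by move=> x y xy; have := no_edge x y; rewrite xy.
have [x [y xy]] := chromatic_number_gt1 q_gt1.
have /andP[d_gt0 D_gt0] := degenerate_edge_gt0 H_degenerate xy.
have [v v_bij deg] := H_degenerate.
apply: le_trans (bound_le R _ q_gt1 (chromatic_number_le v_bij _) D_gt0).
  by rewrite ler_nat; apply: ramsey_number_le_bound.
by move=> i; case: (deg i).
Qed.
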